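(* Let $X$ be an infinite Hausdorff topological space and let $H=\mathrm{USC}_p^{*}(X)$. Let either $\Phi=\Omega$ and $\tilde\Phi^{\uparrow}=\mathcal D^{\uparrow}$, or $\Phi=\Gamma$ and $\tilde\Phi^{\uparrow}=\mathcal S^{\uparrow}$. Then the following are equivalent: (a) $H$ satisfies the selection principle $\mathrm S_1(\tilde\Phi^{\uparrow}(H),\mathcal S(H))$. (b) $H$ is sequentially separable and $X$ has the covering property $\mathrm S_1(\Phi(X),\Gamma(X))$. (c) $H$ is sequentially separable and satisfies the selection principle $\mathrm S_1(\Phi_h(H),\Gamma_h(H))$ for every $h\in H$. (d) $H$ is sequentially separable and satisfies the selection principle $\mathrm S_1(\Gamma_{\mathbf 0}(H),\Gamma_{\mathbf 0}(H))$ and the selection principle $\mathrm S_1(\tilde\Phi^{\uparrow}(H),\Gamma_h(H))$ for every $h\in H$.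
   Context: The set ${}^X\mathbb R$ of all real functions on $X$ carries the product topology (pointwise convergence). $\mathrm{USC}_p^{*}(X)$ is the subspace of all bounded upper semicontinuous functions $f:X\to\mathbb R$ (i.e. $\{x:f(x)<a\}$ is open for every real $a$). $\mathbf 0$ is the constant zero function on $X$. Covers: an $\omega$-cover of $X$ is a cover $\mathcal U$ with $X\notin\mathcal U$ such that every finite $F\subseteq X$ is contained in some $U\in\mathcal U$. A $\gamma$-cover is an infinite cover $\mathcal U$ such that for every $x\in X$ the set $\{U\in\mathcal U:x\notin U\}$ is finite. $\Omega(X)$, $\Gamma(X)$ are the families of all open $\omega$-covers and of all open $\gamma$-covers. $\mathrm S_1(\mathcal A,\mathcal B)$, for families $\mathcal A,\mathcal B$ of subsets of a set: for every sequence $\langle A_n:n\in\omega\rangle$ of elements of $\mathcal A$ there are $a_n\in A_n$ ($n\in\omega$) with $\{a_n:n\in\omega\}\in\mathcal B$. For $h\in{}^X\mathbb R$ and a family $F$ of real functions on $X$: $F$ has property $(\Omega_h)$ if $h\notin F$ and $h\in\overline F$ in ${}^X\mathbb R$; $F$ has property $(\Gamma_h)$ if $F$ is infinite and for every $\varepsilon>0$ and $x\in X$ the set $\{f\in F:|f(x)-h(x)|\ge\varepsilon\}$ is finite. For $H\subseteq{}^X\mathbb R$, $\Phi_h(H)$ is the set of all $F\subseteq H$ having property $(\Phi_h)$ and such that $f\ge h$ and $f-h\in H$ for every $f\in F$. For $F\subseteq H\subseteq{}^X\mathbb R$: $F$ is sequentially dense in $H$ if every $f\in H$ is the pointwise limit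 of a sequence of elements of $F$; $\mathcal S(H)$ is the set of all such $F$; $H$ is sequentially separable if it has a countable sequentially dense subset. $F$ is upper sequentially dense in $H$ if for every $f\in H$ there is a sequence $\langle h_n:n\in\omega\rangle$ of elements of $F$ with $h_n\to f$ pointwise, $h_n\ge f$ and $h_n-f\in H$ for all $n$. $F$ is upper dense in $H$ if for every $f\in H$ the set $\{h\in F:h\ge f\wedge h-f\in H\}$ is dense in $\{h\in H:h\ge f\}$. $\mathcal S^{\uparrow}(H)$, $\mathcal D^{\uparrow}(H)$ are the sets of all upper sequentially dense, resp. upper dense, subsets of $H$. *)

(* Defs.v *)
From HB Require Import structures.
From mathcomp Require Import all_boot all_order all_algebra.
From mathcomp Require Import all_classical all_reals all_analysis.

Set Implicit Arguments.
Unset Strict Implicit.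
Unset Printing Implicit Defensive.

Import Order.TTheory GRing.Theory Num.Theory.
Import numFieldNormedType.Exports.

Local Open Scope classical_set_scope.
Local Open Scope ring_scope.

(* [{ptws X -> R}] is the product topology on [X -> R]; closures and limits of
   functions are always taken there, never in the uniform topology. *)

Definition S1 (T : Type) (A B : set (set T)) : Prop :=
  forall F : nat -> set T, (forall n, A (F n)) ->
    exists2 a : nat -> T, (forall n, F n (a n)) & B (range a).

(* The letter Phi, ranging over {Omega, Gamma}. *)
Inductive kind := Omega | Gamma.

Section covers.
Variable X : topologicalType.
Implicit Types U : set (set X).

Definition is_cover U : Prop := cover U id = [set: X].

Definition omega_cover U : Prop :=
  [/\ is_cover U, ~ U [set: X] &
      forall F : set X, finite_set F -> exists2 A, U A & F `<=` A].

Definition gamma_cover U : Prop :=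
  [/\ is_cover U, infinite_set U &
      forall x : X, finite_set [set A | U A /\ ~ A x]].

Definition open_covers (Phi : kind) : set (set (set X)) :=
  [set U | U `<=` open /\
    match Phi with Omega => omega_cover U | Gamma => gamma_cover U end].

End covers.

Section functions.
Variables (R : realType) (X : topologicalType).
Implicit Types (f g h : X -> R) (F H : set (X -> R)).

Definition USCb : set (X -> R) :=
  [set f : X -> R | bounded_fun f /\ forall a : R, open [set x | f x < a]].

Definition above h : set (X -> R) := [set f : X -> R | forall x, h x <= f x].

Definition prop_at (Phi : kind) h F : Prop :=
  match Phi with
  | Omega => ~ F h /\ closure (F : set {ptws X -> R}) h
  | Gamma => infinite_set F /\
      forall (e : R) (x : X), 0 < e ->
        finite_set [set f | F f /\ e <= `|f x - h x|]
  end.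

Definition families_at (Phi : kind) h H : set (set (X -> R)) :=
  [set F | [/\ F `<=` H, prop_at Phi h F &
    forall f, F f -> above h f /\ H (f \- h)]].

Definition seq_dense H : set (set (X -> R)) :=
  [set F | F `<=` H /\
    forall f, H f -> exists2 u : nat -> X -> R,
      (forall n, F (u n)) & {ptws, u @ \oo --> f}].

Definition seq_separable H : Prop :=
  exists2 F, countable F & seq_dense H F.

Definition upper_seq_dense H : set (set (X -> R)) :=
  [set F | F `<=` H /\
    forall f, H f -> exists2 u : nat -> X -> R,
      (forall n, [/\ F (u n), above f (u n) & H (u n \- f)]) &
      {ptws, u @ \oo --> f}].

Definition dense_in F H : Prop :=
  F `<=` H /\ H `<=` closure (F : set {ptws X -> R}).

Definition upper_dense H : set (set (X -> R)) :=
  [set F | F `<=` H /\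
    forall f, H f -> dense_in [set h | [/\ F h, above f h & H (h \- f)]]
                              (H `&` above f)].

(* D^up for Omega, S^up for Gamma *)
Definition upper_families (Phi : kind) H : set (set (X -> R)) :=
  match Phi with Omega => upper_dense H | Gamma => upper_seq_dense H end.

End functions.

Arguments USCb : clear implicits.

(* Main.v *)
(* Each of (a)-(d) is compared with one selection principle for sequences of
   open families U_n: choose V_n in U_n so that every point lies in V_n for all
   large n. Sequences, unlike the ranges occurring in S_1, tolerate repetitions,
   and no side condition X \notin U_n is needed; passing to common refinements
   of U_0, ..., U_n makes this principle equivalent to S_1(Phi(X), Gamma(X)).
   Functions are tied to open sets by f |-> {f < 1/(n+1)} in one direction and
   by U |-> c 1_{X \ U} in the other; adding large steps c 1_{X \ U} to
   arbitrary functions turns a cover into an upper (sequentially) dense set.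
   For (d) => (a), split the sequence of families into countably many
   subsequences, use the k-th one to approach the k-th member of a countable
   sequentially dense set from above, and diagonalize with the selection
   principle. *)
Require Import Defs.
From HB Require Import structures.
From mathcomp Require Import all_boot all_order all_algebra.
From mathcomp Require Import all_classical all_reals all_analysis.
From mathcomp Require Import lra.

Import Order.TTheory GRing.Theory Num.Theory.
Import numFieldNormedType.Exports.

Set Implicit Arguments.
Unset Strict Implicit.
Unset Printing Implicit Defensive.

Local Open Scope classical_set_scope.
Local Open Scope ring_scope.

(** * Finite intersections in filters, and sequences in infinite sets *)

Lemma near_finite {T : Type} {I : choiceType} {F : set_system T}
    {D : set I} (P : I -> T -> Prop) : Filter F ->
  finite_set D -> (forall i, D i -> \forall t \near F, P i t) ->
  \forall t \near F, forall i, D i -> P i t.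
Proof.
move=> FF finD DP; have := @filter_bigI T I (fset_set D) P F FF.
rewrite fset_setK// => h; apply: filterS (h _) => [t + i Di|i].
  by move/(_ i Di).
by rewrite in_fset_set// inE; exact: DP.
Qed.

Lemma infinite_set_seq (T : Type) (F : set T) : infinite_set F ->
  exists2 u : nat -> T, (forall n, F (u n)) &
    forall A, finite_set A -> \forall n \near \oo, ~ A (u n).
Proof.
elim/Ppointed: T => T in F *.
  by rewrite emptyE_subdef => /infinite_setN0 [].
move=> /infiniteP/pcard_leP/injfunPex[u uF uI]; exists u => [n|A finA].
  exact: uF.
have fin : finite_set (u @^-1` A).
  by apply: finite_preimage => // x y _ _; apply: uI; rewrite inE.
have : \forall n \near \oo, forall i, (u @^-1` A) i -> n != i.
  apply: near_finite => // i _; exists i.+1 => // n /= lt_in.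
  by rewrite gtn_eqF.
by apply: filterS => n h An; have := h _ An; rewrite eqxx.
Qed.

(** Each value [u m] violates some [P i], which holds eventually; if the range were finite, [u n]
    would eventually avoid all of its values. *)
Lemma range_eventually (T : choiceType) (I : Type) (P : I -> set T)
    (u : nat -> T) :
  (forall i, \forall n \near \oo, P i (u n)) ->
  (forall n, exists i, ~ P i (u n)) ->
  infinite_set (range u) /\
  forall i, finite_set [set t | range u t /\ ~ P i t].
Proof.
move=> evP nP; split=> [fin|i].
  have : \forall n \near \oo, forall t, range u t -> u n <> t.
    apply: (@near_finite _ _ _ _ (fun t n => u n <> t)) => // _ [m _ <-].
    have [i ni] := nP m; have := evP i.
    by apply: filterS => n Pn unm; apply: ni; rewrite -unm.
  by move=> /filter_ex[n /(_ (u n))[]].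
have [N _ hN] := evP i.
apply: (@sub_finite_set _ _ (u @` `I_N)); last first.
  by apply: finite_image; exact: finite_II.
move=> _ [[n _ <-] nPn]; exists n => //=; rewrite ltnNge.
by apply/negP => /hN.
Qed.

(** * Open covers and eventual selection *)

Section selection.
Context {X : topologicalType}.
Implicit Types (U : set (set X)) (Phi : kind).

(** The member X is allowed, and for [Gamma] the family need only contain a suitable sequence,
    possibly with repetitions; hence [fine] passes to larger families. *)
Definition fine Phi U : Prop :=
  match Phi with
  | Omega => forall S : set X, finite_set S -> exists2 A, U A & S `<=` A
  | Gamma => exists2 s : nat -> set X, (forall m, U (s m)) &
      forall x, \forall m \near \oo, s m x
  end.

Definition eventual_selection Phi : Prop :=
  forall U : nat -> set (set X), (forall n, U n `<=` open /\ fine Phi (U n)) ->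
    exists2 V : nat -> set X, (forall n, U n (V n)) &
      forall x, \forall n \near \oo, V n x.

Lemma fine_Gamma_Omega U : fine Gamma U -> fine Omega U.
Proof.
move=> [s Us sP] S finS.
have /filter_ex[m sm] : \forall m \near \oo, forall x, S x -> s m x.
  by apply: near_finite.
by exists (s m).
Qed.

Lemma eventual_selection_Gamma Phi :
  eventual_selection Phi -> eventual_selection Gamma.
Proof.
case: Phi => // sel U Uf; apply: sel => n; have [? ?] := Uf n; split=> //.
exact: fine_Gamma_Omega.
Qed.

(** Intersect members of [U 0], ..., [U n] containing the same finite set, respectively the m-th
    terms of the witnessing sequences. *)
Lemma fine_common_refinement Phi (U : nat -> set (set X)) n :
  (forall i, U i `<=` open /\ fine Phi (U i)) ->
  fine Phi [set A | open A /\
    forall i, (i <= n)%N -> exists2 V, U i V & A `<=` V].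
Proof.
have cap (V : nat -> set X) : (forall i, open (V i)) ->
    open (\bigcap_(i in `I_n.+1) V i).
  move=> oV; rewrite openE => x Vx; apply: near_finite => [|i /Vx Vix].
    exact: finite_II.
  exact: open_nbhs_nbhs.
have sub (V : nat -> set X) i : (i <= n)%N ->
    \bigcap_(j in `I_n.+1) V j `<=` V i.
  by move=> ilen x; apply; rewrite /= ltnS.
case: Phi => Uf.
  move=> S finS.
  have /choice[V VP] i : exists V, U i V /\ S `<=` V.
    by have [V] := (Uf i).2 S finS; exists V.
  exists (\bigcap_(i in `I_n.+1) V i); last first.
    by move=> x Sx i _; exact: (VP i).2.
  split; first by apply: cap => i; apply: (Uf i).1; exact: (VP i).1.
  by move=> i ilen; exists (V i); [exact: (VP i).1|exact: sub].
have /choice[s sP] i : exists s : nat -> set X, (forall m, U i (s m)) /\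
    forall x, \forall m \near \oo, s m x.
  by have [s] := (Uf i).2; exists s.
exists (fun m => \bigcap_(i in `I_n.+1) s i m) => [m|x].
  split; first by apply: cap => i; apply: (Uf i).1; exact: (sP i).1.
  by move=> i ilen; exists (s i m); [exact: (sP i).1|exact: (sub (s^~ m))].
apply: (@near_finite _ _ _ _ (fun i m => s i m x)) => [|i _].
  exact: finite_II.
exact: (sP i).2.
Qed.

(* Selecting from common refinements of the first families, a subsequence of
   the selected sets can be stretched back into a full sequence; properness of
   the sets forces the indices of the subsequence to tend to infinity. *)
Lemma eventual_selection_subseq Phi :
  (forall U : nat -> set (set X),
    (forall n, [/\ U n `<=` open, fine Phi (U n) & ~ U n [set: X]]) ->
    exists2 V : nat -> set X, (forall n, U n (V n)) &
      exists p : nat -> nat, forall x, \forall k \near \oo, V (p k) x) ->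
  eventual_selection Phi.
Proof.
move=> sub U Uf.
have [UT|/existsNP[n0 nUT]] := pselect (forall n, U n [set: X]).
  by exists (fun=> setT) => // x; exact: nearW.
(* Including [n0] in every refinement keeps X out of [W n]. *)
pose W n := [set A | open A /\
  forall i, (i <= n0 + n)%N -> exists2 V, U i V & A `<=` V].
have WT n : ~ W n setT.
  move=> [_ /(_ n0 (leq_addr _ _))[V UV]]; rewrite subTset => VT.
  by apply: nUT; rewrite -VT.
have [|A WA [p Ap]] := sub W.
  by move=> n; split=> //; [move=> ? []|exact: fine_common_refinement].
(* Since [A i] misses some point, [p k = i] fails for all large [k]. *)
have pinf n : \forall k \near \oo, forall i, `I_n i -> p k <> i.
  apply: near_finite; first exact: finite_II.
  move=> i _; have /existsNP[x Ax] : ~ forall x, A i x.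
    by move=> AiT; apply: (WT i); rewrite -(_ : A i = setT)// -subTset => x _.
  by apply: filterS (Ap x) => k Akx pki; apply: Ax; rewrite -pki.
(* [n <= p k] puts [A (p k)] inside a member of [U n]; [n <= k] carries eventual membership over
   from [k] to [n]. *)
have /choice[K KP] n : exists k, (n <= k)%N /\ (n <= p k)%N.
  suff /filter_ex : \forall k \near \oo, (n <= k)%N /\ (n <= p k)%N by [].
  apply: filterS2 (nbhs_infty_ge n) (pinf n) => k nk pk.
  by split=> //; rewrite leqNgt; apply/negP => /pk.
have /choice[V VP] n : exists V, U n V /\ A (p (K n)) `<=` V.
  have [|V] := (WA (p (K n))).2 n; last by exists V.
  by rewrite (leq_trans (KP n).2)// leq_addl.
exists V => [n|x]; first exact: (VP n).1.
have [N _ NP] := Ap x; exists N => // n /= Nn; apply: (VP n).2; apply: NP.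
by rewrite /= (leq_trans Nn)// (KP n).1.
Qed.

Lemma gamma_cover_range (s : nat -> set X) :
  (forall n, s n != [set: X]) -> (forall x, \forall n \near \oo, s n x) ->
  gamma_cover (range s).
Proof.
move=> sT evs; have [||? ?] := @range_eventually _ _ (fun x A => A x) s.
- exact: evs.
- move=> n; apply/existsNP => sn; move: (sT n) => /eqP; apply.
  by apply/seteqP; split.
split=> //; apply/seteqP; split=> // x _.
by have [n snx] := filter_ex (evs x); exists (s n) => //; exists n.
Qed.

(** Removing X, which a gamma-cover may contain, keeps later selections proper and so makes their
    range infinite. *)
Lemma open_covers_fine Phi U :
  open_covers Phi U -> fine Phi (U `\ [set: X]).
Proof.
case: Phi => -[oU].
  move=> [_ UT Uf] S /Uf[A UA SA]; exists A => //; split=> //.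
  by move=> /= AT; rewrite AT in UA.
move=> [_ infU finU].
have /infinite_set_seq[s sU ev] : infinite_set (U `\ [set: X]).
  by apply: infinite_setD => //; exact: finite_set1.
exists s => // x; have := ev _ (finU x); apply: filterS => n /not_andP[].
  by move=> /(_ (sU n).1).
exact: contrapT.
Qed.

(** For [Gamma] only the range of the witnessing sequence is kept, since infinitely many other
    members of [U] may miss a given point. *)
Lemma fine_open_covers Phi U :
  U `<=` open -> ~ U [set: X] -> fine Phi U ->
  exists2 W, W `<=` U & open_covers Phi W.
Proof.
move=> oU UT; case: Phi => [Uf|[s Us ev]].
  exists U => //; split=> //; split=> //.
  apply/seteqP; split=> // x _.
  by have [A UA xA] := Uf [set x] (finite_set1 x); exists A => //; exact: xA.
exists (range s); first by move=> _ [n _ <-].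
split; first by move=> _ [n _ <-]; exact: oU.
apply: gamma_cover_range => // n.
by apply/eqP => snT; apply: UT; rewrite -snT.
Qed.

Lemma eventual_selectionP Phi :
  S1 (@open_covers X Phi) (@open_covers X Gamma) <-> eventual_selection Phi.
Proof.
split=> [selS1|sel U Uc].
  apply: eventual_selection_subseq => U Uf.
  have /choice[W WP] n : exists W, W `<=` U n /\ open_covers Phi W.
    by have [oU fU UT] := Uf n; have [W] := fine_open_covers oU UT fU; exists W.
  have [V WV [_ [_ infV finV]]] := selS1 W (fun n => (WP n).2).
  exists V => [n|]; first exact: (WP n).1.
  (* [S1] controls only the range, so a sequence leaving every finite set is drawn from it and read
     as [V (p k)]. *)
  have [s sV ev] := infinite_set_seq infV.
  have /choice[p pP] k : exists n, V n = s k by have [n _] := sV k; exists n.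
  exists p => x; apply: filterS (ev _ (finV x)) => k.
  by rewrite pP => /not_andP[/(_ (sV k))//|/contrapT].
have [|V UV evV] := sel (fun n => U n `\ [set: X]).
  move=> n; split; last exact: open_covers_fine.
  by move=> A [/(Uc n).1].
exists V => [n|]; first exact: (UV n).1.
split; first by move=> _ [n _ <-]; apply: (Uc n).1; exact: (UV n).1.
by apply: gamma_cover_range => // n; apply/eqP; exact: (UV n).2.
Qed.

End selection.

(** * Pointwise convergence and closure of families of functions *)

Section functions.
Context {R : realType} {X : topologicalType}.
Implicit Types (f g h : X -> R) (F G : set (X -> R)) (Phi : kind).
Local Notation H := (USCb R X).

Lemma ptws_cvg_seqP (u : nat -> X -> R) f :
  {ptws, u @ \oo --> f} <->
  forall x e, 0 < e -> \forall n \near \oo, `|u n x - f x| < e.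
Proof.
split=> [/pointwise_cvgP uf x e e0|uf]; last apply/pointwise_cvgP => x.
  have /cvgrPdistC_lt := uf x.
  exact.
by apply/cvgrPdistC_lt => e e0; exact: uf.
Qed.

(** The sets of functions agreeing with [h] on a finite set generate a filter converging to [h], so
    every neighbourhood of [h] contains one of them. *)
Lemma closure_agree_finite G h :
  (forall S : set X, finite_set S -> exists2 g, G g & {in S, g =1 h}) ->
  closure (G : set {ptws X -> R}) h.
Proof.
move=> Gh.
pose agree (S : set X) := [set g : X -> R | {in S, g =1 h}].
pose N := filter_from (@finite_set X) agree.
have FN : Filter N.
  apply: filter_from_filter; first by exists set0; exact: finite_set0.
  move=> S S' finS finS'; exists (S `|` S'); first by rewrite finite_setU.
  by move=> g gh; split=> x /set_mem Sx; apply: gh; rewrite inE; [left|right].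
have Nh : {ptws, N --> h}.
  apply/pointwise_cvgP => x A Ahx; exists [set x]; first exact: finite_set1.
  move=> g gh /=; rewrite gh ?inE//; exact: nbhs_singleton.
move=> B /Nh[S finS SB]; have [g Gg gh] := Gh S finS.
by exists g; split=> //; exact: SB.
Qed.

Lemma closure_near_finite G h (S : set X) (e : R) :
  closure (G : set {ptws X -> R}) h -> finite_set S -> 0 < e ->
  exists2 g, G g & forall x, S x -> `|g x - h x| < e.
Proof.
move=> Gh finS e0.
have : \forall g \near (h : {ptws X -> R}), forall x, S x -> `|g x - h x| < e.
  apply: (@near_finite {ptws X -> R} X (nbhs (h : {ptws X -> R})) S
    (fun x g => `|g x - h x| < e) (nbhs_filter _) finS).
  have : {ptws, nbhs (h : {ptws X -> R}) --> h} by [].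
  move=> /pointwise_cvgP hh x _.
  have Fh : Filter (nbhs (h : {ptws X -> R})) by exact: nbhs_filter.
  by have := (@cvgrPdistC_lt _ _ _ _ Fh _ _).1 (hh x) e e0.
by move=> /Gh[g [Gg gh]]; exists g.
Qed.

(** The counterpart of [fine] for functions; [h] itself may belong to [G]. *)
Definition approached Phi h G : Prop :=
  match Phi with
  | Omega => closure (G : set {ptws X -> R}) h
  | Gamma => exists2 u : nat -> X -> R, (forall m, G (u m)) &
      {ptws, u @ \oo --> h}
  end.

Lemma fine_approached Phi (U : set (set X)) h G : fine Phi U ->
  (forall A, U A -> exists2 g, G g & {in A, g =1 h}) -> approached Phi h G.
Proof.
case: Phi => [Uf UG|[s Us ev] UG].
  apply: closure_agree_finite => S /Uf[A /UG[g Gg gh] SA].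
  by exists g => // x /set_mem Sx; apply: gh; rewrite inE; exact: SA.
have /choice[u uP] m : exists g, G g /\ {in s m, g =1 h}.
  by have [g] := UG _ (Us m); exists g.
exists u => [m|]; first exact: (uP m).1.
apply/ptws_cvg_seqP => x e e0; apply: filterS (ev x) => n snx.
by rewrite (uP n).2 ?inE// subrr normr0.
Qed.

(** The bound is one-sided because it is applied to [g >= h], and because these sets are open when
    [g - h] is upper semicontinuous. *)
Lemma approached_fine Phi h G (e : R) : approached Phi h G -> 0 < e ->
  fine Phi [set [set x | g x - h x < e] | g in G].
Proof.
case: Phi => [Gh e0 S finS|[u Gu /ptws_cvg_seqP uh] e0].
  have [g Gg gh] := closure_near_finite Gh finS e0.
  exists [set x | g x - h x < e]; first by exists g.
  by move=> x /gh /=; exact: le_lt_trans (ler_norm _).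
exists (fun m => [set x | u m x - h x < e]) => [m|x]; first by exists (u m).
by apply: filterS (uh x e e0) => n; exact: le_lt_trans (ler_norm _).
Qed.

Lemma prop_at_Gamma_range (u : nat -> X -> R) h : (forall n, u n <> h) ->
  {ptws, u @ \oo --> h} -> prop_at Gamma h (range u).
Proof.
move=> uh /ptws_cvg_seqP cvu.
have [||infu finu] := @range_eventually _ _
  (fun (xe : X * {posnum R}) g => `|g xe.1 - h xe.1| < xe.2%:num) u.
- by move=> [x e]; exact: cvu.
- move=> n; have /existsNP[x ux] : ~ u n =1 h by move=> /funext/uh.
  have ux0 : 0 < `|u n x - h x| by rewrite normr_gt0 subr_eq0; exact/eqP.
  (* The distance from [h] at a point where [u n] differs is the tolerance that [u n] violates. *)
  by exists (x, PosNum ux0); rewrite /= ltxx.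
split=> // e x e0; apply: sub_finite_set (finu (x, PosNum e0)) => g [ug /=].
by rewrite leNgt => /negP.
Qed.

Lemma prop_at_approached Phi h F :
  prop_at Phi h F -> approached Phi h (F `\ h).
Proof.
case: Phi => [[nFh]|[infF finF]].
  rewrite (_ : F `\ h = F)//; apply/seteqP; split=> [f []//|f Ff].
  by split=> // fh; rewrite -fh in nFh.
have /infinite_set_seq[u uF ev] : infinite_set (F `\ h).
  by apply: infinite_setD => //; exact: finite_set1.
exists u => //; apply/ptws_cvg_seqP => x e e0.
apply: filterS (ev _ (finF e x e0)) => n /not_andP[|/negP].
  by move=> /(_ (uF n).1).
by rewrite -ltNge.
Qed.

Lemma approached_prop_at Phi h G : approached Phi h G -> ~ G h ->
  exists2 F, F `<=` G & prop_at Phi h F.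
Proof.
case: Phi => [Gh nGh|[u Gu uh] nGh]; first by exists G.
exists (range u); first by move=> _ [n _ <-].
by apply: prop_at_Gamma_range => // n unh; apply: nGh; rewrite -unh.
Qed.

(** * Bounded upper semicontinuous functions *)

Lemma bounded_funP_le f : bounded_fun f <-> exists M : R, forall x, `|f x| <= M.
Proof.
split=> [/ex_strict_bound_gt0[M _ fM]|[M fM]].
  by exists M => x; exact/ltW/fM.
by exists M; split; [exact: num_real|move=> N MN x _; exact: le_trans (ltW MN)].
Qed.

Lemma USCbD f g : H f -> H g -> H (f \+ g).
Proof.
move=> [/bounded_funP_le[M fM] of_] [/bounded_funP_le[N gN] og]; split.
  apply/bounded_funP_le; exists (M + N) => x.
  by rewrite (le_trans (ler_normD _ _))// lerD.
move=> a; rewrite openE => x /= fgx.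
pose e := (a - (f x + g x)) / 2.
have e0 : 0 < e by rewrite divr_gt0// subr_gt0.
have : nbhs x ([set y | f y < f x + e] `&` [set y | g y < g x + e]).
  by apply: filterI; apply: open_nbhs_nbhs; split=> //=; rewrite ltrDl.
apply: filterS => y [/= fy gy]; rewrite (lt_le_trans (ltrD fy gy))//.
by rewrite /e; lra.
Qed.

Lemma USCb_cst (c : R) : H (cst c).
Proof.
split; first by apply/bounded_funP_le; exists `|c|.
move=> a; have [ca|ac] := ltP c a.
  by rewrite (_ : mkset _ = setT); [exact: openT|apply/seteqP; split].
rewrite (_ : mkset _ = set0); first exact: open0.
by apply/seteqP; split=> // x /=; rewrite ltNge ac.
Qed.

(** The patched function is nonnegative: its sublevel set at [a] is empty for [a <= 0] and the
    complement of the given closed set for [a > 0]. *)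
Lemma USCb_patch (A : set X) g : bounded_fun g -> {in A, forall x, 0 <= g x} ->
  (forall a, closed [set x | A x /\ a <= g x]) -> H (patch (cst 0) A g).
Proof.
move=> /bounded_funP_le[M gM] g0 clg; split.
  apply/bounded_funP_le; exists M => x; rewrite patchE.
  by case: ifPn => // _; rewrite normr0 (le_trans _ (gM x)).
move=> a; have [a0|a0] := ltP 0 a.
  rewrite (_ : mkset _ = ~` [set x | A x /\ a <= g x]); first exact/closed_openC.
  apply/seteqP; split=> x /=; rewrite patchE.
    by case: ifPn => [_ gx [_]|/negP nAx _ [/mem_set//]]; rewrite leNgt gx.
  by case: ifPn => // /set_mem Ax gx; rewrite ltNge; apply/negP => agx;
  exact: gx.
rewrite (_ : mkset _ = set0); first exact: open0.
apply/seteqP; split=> // x /=; rewrite patchE ltNge; apply: contraNP => _.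
by case: ifPn => [/g0|_]; exact: le_trans.
Qed.

Lemma USCb_open_step (A : set X) (c : R) : open A -> 0 <= c ->
  H (patch (cst 0) (~` A) (cst c)).
Proof.
move=> oA c0; apply: USCb_patch => // [|a]; first exact: (USCb_cst c).1.
have [ac|ca] := leP a c.
  rewrite (_ : mkset _ = ~` A); first exact: open_closedC.
  by apply/seteqP; split=> [x []|x].
rewrite (_ : mkset _ = set0); first exact: closed0.
by apply/seteqP; split=> // x [_ /=].
Qed.

Lemma USCb_finite_step (S : set X) g : hausdorff_space X -> finite_set S ->
  bounded_fun g -> {in S, forall x, 0 <= g x} -> H (patch (cst 0) S g).
Proof.
move=> hX finS bg g0; apply: USCb_patch => // a.
have fin : finite_set [set x | S x /\ a <= g x].
  by apply: sub_finite_set finS => x [].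
by move/hausdorff_accessible/accessible_finite_set_closed: hX; apply.
Qed.

(** * Selecting convergent sequences of functions *)

Lemma selection_cvg Phi (h : nat -> X -> R) (G : nat -> set (X -> R)) l :
  @eventual_selection X Phi ->
  (forall n g, G n g -> above (h n) g /\ H (g \- h n)) ->
  (forall n, approached Phi (h n) (G n)) -> {ptws, h @ \oo --> l} ->
  exists2 f : nat -> X -> R, (forall n, G n (f n)) & {ptws, f @ \oo --> l}.
Proof.
move=> sel GH Gh /ptws_cvg_seqP hl.
(* At each point eventually [h n <= f n < h n + 1/(n+1)], so the selected functions share the limit
   of the moving targets [h n]. *)
have [|V VP ev] :=
  sel (fun n => [set [set x | g x - h n x < n.+1%:R^-1] | g in G n]).
  move=> n; split; last by apply: approached_fine.
  by move=> _ [g /GH[_ [_ og]] <-]; exact: og.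
have /choice[f fP] n : exists f, G n f /\
    [set x | f x - h n x < n.+1%:R^-1] = V n by have [f] := VP n; exists f.
exists f => [n|]; first exact: (fP n).1.
apply/ptws_cvg_seqP => x e e0; have e20 : 0 < e / 2 by rewrite divr_gt0.
apply: filterS3 (ev x) (hl x _ e20) (near_infty_natSinv_lt (PosNum e20)) => n.
rewrite -(fP n).2 /= => fh hln ne; have hf := (GH n _ (fP n).1).1 x.
have {fh ne} fh := lt_trans fh ne.
by move: hln; rewrite !ltr_norml => /andP[? ?]; apply/andP; split; lra.
Qed.

(** * Upper dense families and covers *)

Lemma upper_families_sub Phi F : upper_families Phi H F -> F `<=` H.
Proof. by case: Phi => -[]. Qed.

Lemma upper_families_approached Phi F h : upper_families Phi H F -> H h ->
  approached Phi h [set f | [/\ F f, above h f & H (f \- h)]].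
Proof.
case: Phi => -[_ FP] Hh; last exact: FP.
(* [h] itself lies in [H] above [h], where the family is dense. *)
by apply: (FP h Hh).2; split=> // x.
Qed.

(** The function [f + v + c 1_{X \ A}] equals [f + v] on [A] and is at least 1 off [A]. Taking
    [v = 0] approaches [f]; a finitely supported [v] approaches any [g >= f]. *)
Lemma upper_families_fine Phi (U : set (set X)) : hausdorff_space X ->
  U `<=` open -> fine Phi U ->
  upper_families Phi H
    [set f | H f /\ exists2 A, U A & forall x, ~ A x -> 1 <= f x].
Proof.
move=> hX oU fU; set B := [set f | _].
have lift f v A : H f -> H v -> (forall x, 0 <= v x) -> U A ->
    exists2 k, [/\ B k, above f k & H (k \- f)] & {in A, k =1 f \+ v}.
  move=> Hf Hv v0 UA; have [M fM] := (bounded_funP_le f).1 Hf.1.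
  (* Since [f >= -M], adding [c] lifts [f] to at least 1. *)
  pose c := 1 + `|M|; have c0 : 0 <= c by rewrite addr_ge0.
  have Hs := USCb_open_step (oU _ UA) c0.
  have Hvs := USCbD Hv Hs; have Hk := USCbD Hf Hvs.
  have s0 x : 0 <= patch (cst 0) (~` A) (cst c) x by rewrite patchE; case: ifP.
  exists (f \+ (v \+ patch (cst 0) (~` A) (cst c))); last first.
    by move=> x xA /=; rewrite patchE in_setC xA addr0.
  split; last 2 first.
  - by move=> x /=; rewrite lerDl addr_ge0.
  - rewrite (_ : _ \- f = v \+ patch (cst 0) (~` A) (cst c))//.
    by apply/funext => x /=; rewrite addrAC subrr add0r.
  split=> //; exists A => // x nAx /=; rewrite patchE mem_set//=.
  have := fM x; have := ler_norm M; have := v0 x; rewrite ler_norml.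
  by rewrite /c => ? ? /andP[]; lra.
case: Phi fU => fU; split; [by move=> ? []| |by move=> ? []|] => f Hf; last first.
  pose G := [set h | [/\ B h, above f h & H (h \- f)]].
  apply: (@fine_approached Gamma U f G) => // A UA.
  have [k kP kf] := lift f (cst 0) A Hf (USCb_cst 0) (fun=> lexx _) UA.
  by exists k => // x /kf; rewrite /= addr0.
split=> [k [[Hk _] fk _]//|g [Hg fg]].
apply: closure_agree_finite => S finS; have [A UA SA] := fU S finS.
(* [g - f] need not be upper semicontinuous, but its restriction to the finite set [S], extended by
   0, is. *)
have [||k kP kf] := lift f (patch (cst 0) S (g \- f)) A Hf _ _ UA.
- apply: USCb_finite_step => //; last by move=> x _ /=; rewrite subr_ge0.
  have [M gM] := (bounded_funP_le g).1 Hg.1.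
  have [N fN] := (bounded_funP_le f).1 Hf.1.
  apply/bounded_funP_le; exists (M + N) => x /=.
  by rewrite (le_trans (ler_normB _ _))// lerD.
- by move=> x; rewrite patchE; case: ifP => //= _; rewrite subr_ge0.
exists k => // x xS; rewrite kf/= ?patchE ?xS/= ?subrKC//.
by rewrite inE; apply/SA/set_mem.
Qed.

(** * From selections of functions to selections of open sets *)

Lemma eventual_selection_steps Phi :
  (forall U : nat -> set (set X),
    (forall n, [/\ U n `<=` open, fine Phi (U n) & ~ U n [set: X]]) ->
    exists2 f : nat -> X -> R,
      (forall n, exists2 A, U n A & forall x, ~ A x -> 1 <= f n x) &
      exists2 u : nat -> X -> R, (forall k, range f (u k)) &
        {ptws, u @ \oo --> cst 0}) ->
  @eventual_selection X Phi.
Proof.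
move=> sel; apply: eventual_selection_subseq => U /sel[f fP [u uf]].
move=> /ptws_cvg_seqP u0.
have /choice[V VP] n : exists A, U n A /\ forall x, ~ A x -> 1 <= f n x.
  by have [A] := fP n; exists A.
exists V => [n|]; first exact: (VP n).1.
have /choice[p pP] k : exists n, f n = u k by have [n _] := uf k; exists n.
(* [u k x < 1] forces [x] into [V (p k)]; no monotonicity of [p] is required here. *)
exists p => x; apply: filterS (u0 x 1 ltr01) => k; rewrite -pP subr0 => lt1.
apply: contrapT => /(VP _).2; rewrite leNgt => /negP; apply.
exact: le_lt_trans (ler_norm _) lt1.
Qed.

Lemma upper_families_selection Phi : hausdorff_space X ->
  S1 (upper_families Phi H) (seq_dense H) -> @eventual_selection X Phi.
Proof.
move=> hX sel; apply: eventual_selection_steps => U Uf.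
have [|f fP [_ dense]] := sel (fun n =>
    [set f | H f /\ exists2 A, U n A & forall x, ~ A x -> 1 <= f x]).
  by move=> n; have [? ? _] := Uf n; exact: upper_families_fine.
exists f; first by move=> n; have [_] := fP n.
exact: dense (USCb_cst 0).
Qed.

Lemma families_at_selection Phi :
  S1 (families_at Phi (cst 0) H) (families_at Gamma (cst 0) H) ->
  @eventual_selection X Phi.
Proof.
move=> sel; apply: eventual_selection_steps => U Uf.
pose step (A : set X) : X -> R := patch (cst 0) (~` A) (cst 1).
have /choice[F FP] n : exists F, F `<=` step @` U n /\ prop_at Phi (cst 0) F.
  have [_ fU UT] := Uf n.
  have [||F] := @approached_prop_at Phi (cst 0) (step @` U n); last by exists F.
    apply: fine_approached fU _ => A UA; exists (step A); first by exists A.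
    by move=> x xA; rewrite /step patchE in_setC xA.
  (* A vanishing step would force [A = X]. *)
  move=> [A UA A0]; apply: UT; rewrite (_ : setT = A)//.
  apply/seteqP; split=> // x _; apply: contrapT => nAx.
  have /eqP : step A x = 0 by rewrite A0.
  by rewrite /step patchE mem_set// oner_eq0.
have [|f fF [_ f0 _]] := sel F.
  move=> n; have Hs f : F n f -> H f.
    move=> /(FP n).1[A UA <-]; apply: USCb_open_step => //.
    by have [oU _ _] := Uf n; exact: oU.
  split=> [//||f Ff]; first exact: (FP n).2.
  split; last first.
    rewrite (_ : f \- cst 0 = f); first exact: Hs.
    by apply/funext => x /=; rewrite subr0.
  have [A _ <-] := (FP n).1 _ Ff.
  by move=> x; rewrite /step patchE; case: ifP => //=.
exists f.
  move=> n; have [A UA <-] := (FP n).1 _ (fF n); exists A => // x nAx.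
  by rewrite /step patchE mem_set.
by have [u uf u0] := prop_at_approached f0; exists u => // k; have [] := uf k.
Qed.

(** * From selections of open sets to selections of functions *)

Lemma selection_families_at Phi h : @eventual_selection X Phi ->
  S1 (families_at Phi h H) (families_at Gamma h H).
Proof.
move=> sel F FP.
have [|n||f fF fh] := @selection_cvg Phi (fun=> h) (fun n => F n `\ h) h sel.
- by move=> n g [Fg _]; have [_ _] := FP n; apply.
- by have [_ Fh _] := FP n; exact: prop_at_approached.
- by apply/ptws_cvg_seqP => x e e0; apply: nearW => n; rewrite subrr normr0.
exists f => [n|]; first exact: (fF n).1.
split.
- by move=> _ [n _ <-]; have [FH _ _] := FP n; apply: FH; exact: (fF n).1.
- by apply: prop_at_Gamma_range => // n; exact: (fF n).2.
- by move=> _ [n _ <-]; have [_ _ HF] := FP n; apply: HF; exact: (fF n).1.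
Qed.

(* Approaching h through the functions h + 1/(n+1) keeps the selected functions
   different from h, which makes their range infinite. *)
Lemma selection_upper_families Phi h : [set: X] !=set0 ->
  @eventual_selection X Phi -> H h ->
  S1 (upper_families Phi H) (families_at Gamma h H).
Proof.
move=> [x0 _] sel Hh F FP; pose d n : X -> R := h \+ cst n.+1%:R^-1.
have Hd n : H (d n) := USCbD Hh (USCb_cst _).
have [|n||f fF fh] := @selection_cvg Phi d
    (fun n => [set f | [/\ F n f, above (d n) f & H (f \- d n)]]) h sel.
- by move=> n g [].
- exact: upper_families_approached.
- apply/ptws_cvg_seqP => x e e0.
  apply: filterS (near_infty_natSinv_lt (PosNum e0)) => n.
  by rewrite /d /= addrAC subrr add0r ger0_norm.
have hf n x : h x < f n x.
  by have [_ df _] := fF n; apply: lt_le_trans (df x); rewrite /d /= ltrDl.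
exists f => [n|]; first by have [] := fF n.
split.
- move=> _ [n _ <-]; have [Fn _ _] := fF n; exact: upper_families_sub Fn.
- by apply: prop_at_Gamma_range => // n fnh; have := hf n x0; rewrite fnh ltxx.
- move=> _ [n _ <-]; split=> [x|]; first exact/ltW.
  (* [f n - h] is the sum of [f n - d n] and the constant 1/(n+1). *)
  have [_ _ Hfd] := fF n; have := USCbD Hfd (USCb_cst n.+1%:R^-1).
  congr (H _); apply/funext => x; rewrite /d /=.
  by rewrite opprD addrA subrK.
Qed.

Lemma selection_seq_dense Phi : seq_separable H -> @eventual_selection X Gamma ->
  (forall h, H h -> S1 (upper_families Phi H) (families_at Gamma h H)) ->
  S1 (upper_families Phi H) (seq_dense H).
Proof.
move=> [D cD [DH dense]] sel selH F FP.
have [d Dd] : exists d : nat -> X -> R, D = range d.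
  move: cD => /pfcard_geP[D0|/surjfunPex//].
  by have [u uD _] := dense _ (USCb_cst 0); have := uD 0%N; rewrite D0.
have Hd k : H (d k) by apply: DH; rewrite Dd; exists k.
have /choice[a aP] k : exists a : nat -> X -> R,
    (forall j, F (pickle (k, j)) (a j)) /\ families_at Gamma (d k) H (range a).
  by have [|a] := selH _ (Hd k) (fun j => F (pickle (k, j))); last by exists a.
have [b bF _] := selH _ (Hd 0%N) F FP.
(* [unpickle] may also decode numbers that are not codes, hence the test; [b] fills the remaining
   indices. *)
pose c n := if unpickle n is Some (k, j) then
  if pickle (k, j) == n then a k j else b n else b n.
have ca k j : c (pickle (k, j)) = a k j by rewrite /c pickleK eqxx.
have cF n : F n (c n).
  rewrite /c; case: unpickle => [[k j]|//].
  by case: eqP => // <-; exact: (aP k).1.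
exists c => //; split.
  by move=> _ [n _ <-]; exact: upper_families_sub (FP n) _ (cF n).
move=> g /dense[u uD ug].
have /choice[p pP] i : exists k, d k = u i.
  by have := uD i; rewrite Dd => -[k _]; exists k.
(* The target [u i = d (p i)] is approached from above by values of [a (p i)], all of which occur in
   [c]. *)
have [|i||f fa fg] :=
    @selection_cvg Gamma u (fun i => range (a (p i)) `\ u i) g sel.
- by move=> i f [af _]; have [_ _ H'] := (aP (p i)).2; rewrite -pP; exact: H'.
- apply: prop_at_approached; rewrite -pP.
  by have [_ ? _] := (aP (p i)).2.
- exact: ug.
exists f => // i; have [[j _ <-] _] := fa i.
by exists (pickle (p i, j)).
Qed.

(** The cover [{X}] makes the condition off [A] vacuous, so [H] itself belongs to the upper
    families; a selection from the constant sequence [H] has a countable sequentially dense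
    range. *)
Lemma upper_families_separable Phi : hausdorff_space X ->
  S1 (upper_families Phi H) (seq_dense H) -> seq_separable H.
Proof.
move=> hX sel; have [|f _ fd] := sel (fun=>
    [set f | H f /\ exists2 A, [set setT] A & forall x, ~ A x -> 1 <= f x]).
  move=> _; apply: upper_families_fine => //; first by move=> _ ->; exact: openT.
  case: Phi {sel} => [S _|]; first by exists setT.
  by exists (fun=> setT) => // x; exact: nearW.
by exists (range f) => //; exact: card_image_le.
Qed.

End functions.

(** * The cycle of implications from (a) through (d) *)

Theorem theorem6p1 (R : realType) (X : topologicalType) (Phi : kind)
  (infX : infinite_set [set: X]) (hausX : hausdorff_space X) :
  let H := USCb R X in
  [<-> (* (a) *)
       S1 (upper_families Phi H) (seq_dense H);
       (* (b) *)
       seq_separable H /\ S1 (@open_covers X Phi) (@open_covers X Gamma);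
       (* (c) *)
       seq_separable H /\
       forall h : X -> R, H h -> S1 (families_at Phi h H) (families_at Gamma h H);
       (* (d) *)
       [/\ seq_separable H,
           S1 (families_at Gamma (cst 0) H) (families_at Gamma (cst 0) H) &
           forall h : X -> R, H h ->
             S1 (upper_families Phi H) (families_at Gamma h H)]].
Proof.
move=> H; tfae.
- move=> sel; split; first exact: upper_families_separable sel.
  by apply/eventual_selectionP; exact: (@upper_families_selection R).
- move=> [sepH /eventual_selectionP sel]; split=> // h _.
  exact: selection_families_at.
- move=> [sepH selH].
  (* The case [h = 0] already yields eventual selection, from which both principles of (d)
     follow. *)
  have sel := families_at_selection (selH _ (USCb_cst 0)).
  split=> // [|h Hh].
    by apply: selection_families_at; exact: eventual_selection_Gamma sel.
  by apply: selection_upper_families => //; exact: infinite_setN0.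
- move=> [sepH sel0 selH]; apply: selection_seq_dense => //.
  exact: families_at_selection sel0.
Qed.
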